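(* Let $m, n, d$ be positive integers. Then $R_{2m}(n) = d$ if and only if $\mathsf{s}_{2m}(\mathbb{Z}_2^{d-1}) \leq n < \mathsf{s}_{2m}(\mathbb{Z}_2^d)$.
   Context: $R_{2m}(n)$ denotes the smallest redundancy $n - \dim C$ of a linear binary code $C \subseteq \mathbb{F}_2^n$ (a subspace) of length $n$ which contains no word of Hamming weight $2m$. For a nonnegative integer $d$, $\mathsf{s}_{2m}(\mathbb{Z}_2^d)$ denotes the smallest integer $s$ such that every sequence (repetitions allowed) of length $s$ of elements of $\mathbb{Z}_2^d$ has a subsequence of length $2m$ whose elements sum to $0$ (here $\mathbb{Z}_2^0$ is the trivial group). *)

(* Defs.v *)
From HB Require Import structures.
From mathcomp Require Import all_boot all_order all_algebra.

Set Implicit Arguments.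
Unset Strict Implicit.
Unset Printing Implicit Defensive.

Import GRing.Theory.

Local Open Scope ring_scope.

(* Gives access to the subType structure of {vspace vT} over square matrices,
   from which finiteness over a finite field is inherited. *)
Import VectorInternalTheory.

Section FiniteVspace.

Variables (K : finFieldType) (vT : vectType K).

HB.instance Definition _ := [Countable of {vspace vT} by <:].
HB.instance Definition _ := [Finite of {vspace vT} by <:].

End FiniteVspace.

Definition hamming_weight (n : nat) (x : 'rV['F_2]_n) : nat :=
  #|[set i | x ord0 i != 0]|.

Definition linear_code (n : nat) := {vspace 'rV['F_2]_n}.

(* The subtraction never truncates, since dim C <= n. *)
Definition redundancy (n : nat) (C : linear_code n) : nat := (n - \dim C)%N.

Definition avoids_weight (w n : nat) (C : linear_code n) : bool :=
  [forall x in C, hamming_weight x != w].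

(* The zero code seeds the search; it has no word of weight 2m when m > 0 (for
   m = 0 no code qualifies and the value is meaningless). *)
Definition R2m (m n : nat) : nat :=
  redundancy [arg min_(C < (0%VS : linear_code n) | avoids_weight (2 * m) C)
                redundancy C].

Lemma R2m_spec (m n : nat) (m_gt0 : (0 < m)%N) :
  (exists2 C : linear_code n, avoids_weight (2 * m) C & redundancy C = R2m m n)
  /\ (forall C : linear_code n,
        avoids_weight (2 * m) C -> (R2m m n <= redundancy C)%N).
Proof.
rewrite /R2m; case: arg_minnP => [|C avC minC]; last by split; first by exists C.
apply/forall_inP => x; rewrite memv0 => /eqP ->.
rewrite /hamming_weight (_ : [set i | _] = set0).
  by rewrite cards0 eq_sym muln_eq0 /= -lt0n.
by apply/setP => i; rewrite !inE mxE eqxx.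
Qed.

(* Only the additive group of 'rV['F_2]_d matters here: it is the group Z_2^d,
   trivial for d = 0. *)
Definition has_zero_sum_subseq (k d : nat) (s : seq 'rV['F_2]_d) : bool :=
  [exists t : k.-tuple 'rV['F_2]_d,
    subseq t s && (\sum_(g <- t) g == 0)].

Definition forces_zero_sum (k d l : nat) : bool :=
  [forall s : l.-tuple 'rV['F_2]_d, has_zero_sum_subseq k s].

(* By pigeonhole, some element occurs at least 2m times. *)
Lemma ex_forces_zero_sum (m d : nat) :
  exists l, forces_zero_sum (2 * m) d l.
Proof.
set G := 'rV['F_2]_d; exists (2 * m * #|{: G}|)%N.
apply/forallP => s.
have [g cnt_g] : exists g : G, (2 * m <= count_mem g s)%N.
  apply/existsP; apply: contraT; rewrite negb_exists => /forallP small.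
  have G_gt0 : (0 < #|{: G}|)%N by apply/card_gt0P; exists 0.
  have sumE : (\sum_(g : G) count_mem g s = size s)%N.
    rewrite -sum1_size (eq_bigr (fun g => \sum_(x <- s | x == g) 1)%N).
      rewrite (exchange_big_dep xpredT) //=; apply: eq_bigr => x _.
      by rewrite (big_pred1 x) // => g; rewrite eq_sym.
    by move=> g _; rewrite sum1_count.
  have : (\sum_(g : G) (count_mem g s).+1 <= \sum_(g : G) 2 * m)%N.
    by apply: leq_sum => g _; rewrite ltnNge small.
  under eq_bigr do rewrite -addn1.
  rewrite big_split /= sumE size_tuple !sum_nat_const muln1 mulnC.
  by rewrite -{2}[(_ * (2 * m))%N]addn0 leq_add2l leqNgt G_gt0.
apply/existsP; exists [tuple of nseq (2 * m) g]; apply/andP; split.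
  have : subseq [seq x <- s | x == g] s by exact: filter_subseq.
  have /all_pred1P -> : all (pred1 g) [seq x <- s | x == g].
    exact: filter_all.
  apply: subseq_trans; rewrite size_filter -(subnKC cnt_g) nseqD.
  exact: prefix_subseq.
have g2 : g *+ 2 = 0.
  by rewrite -scaler_nat (_ : 2%:R = 0 :> 'F_2) ?scale0r //; exact: val_inj.
by rewrite big_nseq iter_addr_0 mulrnA g2 mul0rn.
Qed.

Definition s2m (m d : nat) : nat := ex_minn (ex_forces_zero_sum m d).

(* Main.v *)
(* A code of redundancy at most d is contained in, and may be replaced by, the
   kernel of a parity-check matrix with d columns.  Reading the rows of such a
   matrix as a sequence of length n in Z_2^d, the words of weight 2m in the
   kernel are the zero-sum subsequences of length 2m.  Hence R_2m(n) <= d if and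
   only if n < s_2m(Z_2^d), and the theorem compares this for d and d - 1. *)
Require Import Defs.
From mathcomp Require Import all_boot all_order all_algebra.

Set Implicit Arguments.
Unset Strict Implicit.
Unset Printing Implicit Defensive.

Import GRing.Theory.

Local Open Scope ring_scope.

Lemma F2_neq0 (a : 'F_2) : a != 0 -> a = 1.
Proof. by case: a => [[|[|i]] lti] // _; apply: val_inj. Qed.

Lemma mulmx_support_sum (n d : nat) (x : 'rV['F_2]_n) (M : 'M['F_2]_(n, d)) :
  x *m M = \sum_(i | x ord0 i != 0) row i M.
Proof.
rewrite mulmx_sum_row [RHS]big_mkcond; apply: eq_bigr => i _.
by case: eqP => [->|/eqP/F2_neq0->]; rewrite ?scale0r ?scale1r.
Qed.

(** A mask selecting a subsequence of [s] and the support of a binary word are the same datum: the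
    weight is the length selected, and the product with the matrix is the sum selected. *)
Lemma zero_sum_subseqP (k d n : nat) (s : n.-tuple 'rV['F_2]_d) :
  reflect (exists2 x : 'rV['F_2]_n,
             hamming_weight x = k & x *m \matrix_i tnth s i = 0)
          (has_zero_sum_subseq k s).
Proof.
apply: (iffP existsP) => [[t /andP[/subseqP[b _ tE] /eqP sum0]]|[x wx x0]].
  have suppE i : ((\row_j (nth false b j)%:R : 'rV['F_2]_n) ord0 i != 0)
      = nth false b i by rewrite mxE; case: nth.
  exists (\row_j (nth false b j)%:R).
    rewrite -(size_tuple t) tE /hamming_weight -sum1_size big_mask_tuple.
    rewrite -sum1_card; apply: eq_bigl => i.
    by rewrite inE suppE andbT.
  rewrite mulmx_support_sum -[RHS]sum0 tE big_mask_tuple.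
  by apply: eq_big => [i|i _]; rewrite ?suppE ?andbT ?rowK.
pose b := [tuple x ord0 i != 0 | i < n].
have bE (i : 'I_n) : nth false b i = (x ord0 i != 0).
  by rewrite -tnth_nth tnth_mktuple.
have size_t : size (mask b s) == k.
  rewrite -sum1_size big_mask_tuple -wx /hamming_weight -sum1_card.
  by apply/eqP/eq_bigl => i; rewrite inE bE andbT.
exists (Tuple size_t); rewrite mask_subseq big_mask_tuple.
apply/eqP; rewrite -[RHS]x0 mulmx_support_sum.
by apply: eq_big => [i|i _]; rewrite ?bE ?andbT ?rowK.
Qed.

(** The cokernel of a basis matrix of [C] vanishes exactly on [C] and has rank [redundancy C], so a
    column base of it fits into [d] columns. The kernel of [M] lies inside [C] and thus inherits the
    avoidance of a weight. *)
Lemma parity_check (n d : nat) (C : linear_code n) :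
  (redundancy C <= d)%N ->
  exists M : 'M['F_2]_(n, d), forall x, x *m M = 0 -> x \in C.
Proof.
move=> redC; pose B := \matrix_(i < \dim C) (vbasis C)`_i.
have mulB u : u *m B = \sum_i u ord0 i *: (vbasis C)`_i.
  by rewrite mulmx_sum_row; apply: eq_bigr => i _; rewrite rowK.
have B_free : row_free B.
  apply: inj_row_free => u; rewrite mulB => /(freeP (basis_free (vbasisP C))).
  by move=> u0; apply/rowP => i; rewrite u0 mxE.
have rkd : (\rank (cokermx B) <= d)%N by rewrite mxrank_coker (eqP B_free).
(* The factor [pid_mx] pads the column base with zero columns up to width [d]. *)
exists (col_base (cokermx B) *m pid_mx (\rank (cokermx B))) => x.
rewrite mulmxA => x0; have col0 : x *m col_base (cokermx B) = 0.
  (* A second [pid_mx], from width [d] back to the rank, removes the padding. *)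
  rewrite -[LHS]mulmx1 -pid_mx_1 -(pid_mx_id _ _ _ rkd).
  by rewrite [LHS]mulmxA x0 mul0mx.
have : x *m cokermx B = 0.
  by rewrite -(mulmx_base (cokermx B)) [LHS]mulmxA col0 mul0mx.
move/eqP; rewrite -submxE => /submxP[u ->].
rewrite mulB memv_suml // => i _; apply/memvZ/vbasis_mem/mem_nth.
by rewrite size_tuple.
Qed.

(** By rank-nullity the redundancy of the kernel is the dimension of the image, which lies in a
    space of dimension [d]. *)
Lemma kernel_code (n d : nat) (M : 'M['F_2]_(n, d)) :
  exists2 C : linear_code n,
    (redundancy C <= d)%N & forall x, x \in C -> x *m M = 0.
Proof.
have dim_rV k : \dim {:'rV['F_2]_k} = k.
  by rewrite dimvf dim_matrix; exact: mul1n.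
exists (lker (linfun (mulmxr M))) => [|x].
  have := limg_ker_dim (linfun (mulmxr M : 'rV_n -> 'rV_d)) fullv.
  rewrite capfv dim_rV /redundancy => dimE; rewrite -[X in (X - _)%N]dimE.
  by rewrite addKn -[leqRHS]dim_rV dimvS ?subvf.
by rewrite memv_ker lfunE => /eqP.
Qed.

Lemma R2m_leE (m n d : nat) : (0 < m)%N ->
  (R2m m n <= d)%N = ~~ forces_zero_sum (2 * m) d n.
Proof.
move=> m_gt0; have [[C avC redC] minC] := R2m_spec n m_gt0.
apply/idP/forallPn => [|[s /zero_sum_subseqP noz]].
  (* The rows of a parity-check matrix of an optimal code form the sequence without a zero-sum
     subsequence. *)
  rewrite -redC => /parity_check[M kerM].
  exists [tuple row i M | i < n]; apply/zero_sum_subseqP => -[x wx].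
  have -> : \matrix_i tnth [tuple row i M | i < n] i = M.
    by apply/row_matrixP => i; rewrite rowK tnth_mktuple.
  by move/kerM/(forall_inP avC); rewrite wx eqxx.
have [D redD kerD] := kernel_code (\matrix_i tnth s i).
apply: leq_trans (minC D _) redD; apply/forall_inP => x /kerD x0.
by apply/eqP => wx; apply: noz; exists x.
Qed.

Lemma forces_zero_sum_leq (k d l l' : nat) : (l <= l')%N ->
  forces_zero_sum k d l -> forces_zero_sum k d l'.
Proof.
move=> le_ll' /forallP forces; apply/forallP => s.
have size_s : size (take l s) == l by rewrite size_takel ?size_tuple.
have /existsP[t /andP[sub_t sum_t]] := forces (Tuple size_s).
apply/existsP; exists t; rewrite sum_t andbT.
exact: subseq_trans sub_t (take_subseq _ _).
Qed.

(** Forcing persists for longer sequences, so the least forcing length is a threshold. *)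
Lemma s2m_leE (m d n : nat) : (s2m m d <= n)%N = forces_zero_sum (2 * m) d n.
Proof.
rewrite /s2m; case: ex_minnP => l forces_l min_l.
by apply/idP/idP => [/forces_zero_sum_leq|/min_l]; first exact.
Qed.

Theorem theorem9 (m n d : nat)
  (hm : (0 < m)%N) (hn : (0 < n)%N) (hd : (0 < d)%N) :
  R2m m n = d <-> (s2m m d.-1 <= n)%N /\ (n < s2m m d)%N.
Proof.
rewrite ltnNge !s2m_leE -R2m_leE // -[forces_zero_sum _ _ _]negbK -R2m_leE //.
(* As [d] is positive, [d.-1 < R2m m n] reads [d <= R2m m n], and the two bounds pin down the
   value. *)
rewrite -ltnNge prednK //; split=> [->|[le_dR le_Rd]]; first by rewrite leqnn.
by apply/eqP; rewrite eqn_leq le_Rd.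
Qed.
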